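(* For every prime power $q > 2$, Homma's constant satisfies $D(q) \ge 1$.
   Context: Let $q$ be a prime power and $\mathbb{F}_q$ the finite field with $q$ elements. For a positive integer $d$, let $M_q(d)$ denote the maximum of $|\mathcal{X}(\mathbb{F}_q)|$ (the number of $\mathbb{F}_q$-rational points) taken over all irreducible projective curves $\mathcal{X}$ of degree $d$ defined over $\mathbb{F}_q$ lying in a projective space $\mathbb{P}^n$ over $\mathbb{F}_q$ of any dimension $n$ (the dimension is not fixed; the curves need not be nonsingular). Homma's constant is $D(q) := \limsup_{d\to\infty} M_q(d)/d$. *)

(* Defs.v *)
From HB Require Import structures.
From mathcomp Require Import all_boot all_order all_algebra all_field.
From mathcomp Require Import mpoly.
Set Implicit Arguments. Unset Strict Implicit. Unset Printing Implicit Defensive.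
Import GRing.Theory.
Local Open Scope ring_scope.

(** Projective curves in P^n are described by their homogeneous ideal
    I ⊂ R[x_0,...,x_n], given by a finite list [gs] of homogeneous generators
    (every homogeneous ideal is of this form, by Hilbert's basis theorem). *)

Definition in_ideal (R : comNzRingType) (N : nat) (gs : seq {mpoly R[N]})
    (p : {mpoly R[N]}) : Prop :=
  exists cs : 'I_(size gs) -> {mpoly R[N]},
    p = \sum_(i < size gs) cs i * gs`_i.

Definition prime_ideal (R : comNzRingType) (N : nat) (gs : seq {mpoly R[N]}) : Prop :=
  ~ in_ideal gs 1 /\
  forall a b : {mpoly R[N]}, in_ideal gs (a * b) -> in_ideal gs a \/ in_ideal gs b.

Definition homogeneous_gens (R : comNzRingType) (N : nat) (gs : seq {mpoly R[N]}) : Prop :=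
  forall g, g \in gs -> exists k : nat, g \is k.-homog.

(** The ideal stays prime over every algebraically closed extension of F,
    i.e. the projective variety it defines is (absolutely / geometrically)
    irreducible. *)
Definition geom_prime (F : fieldType) (N : nat) (gs : seq {mpoly F[N]}) : Prop :=
  forall (K : closedFieldType) (f : {rmorphism F -> K}),
    prime_ideal [seq map_mpoly f g | g <- gs].

Definition hilbert_fn (F : fieldType) (N : nat) (gs : seq {mpoly F[N]})
    (m h : nat) : Prop :=
  exists b : 'I_h -> {mpoly F[N]},
    (forall i, b i \is m.-homog) /\
    (forall c : 'I_h -> F,
        in_ideal gs (\sum_(i < h) c i *: b i) -> forall i, c i = 0) /\
    (forall p : {mpoly F[N]}, p \is m.-homog ->
        exists c : 'I_h -> F, in_ideal gs (p - \sum_(i < h) c i *: b i)).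

(** Irreducible projective curve of degree d in P^n defined over F:
    homogeneous generators, geometrically prime ideal, and Hilbert
    polynomial d*m + c (degree 1, i.e. dimension 1, leading coeff. d). *)
Definition proj_curve (F : fieldType) (n d : nat) (gs : seq {mpoly F[n.+1]}) : Prop :=
  homogeneous_gens gs /\ geom_prime gs /\ (0 < d)%N /\
  exists (c : int) (m0 : nat), forall m : nat, (m0 <= m)%N ->
    exists h : nat, hilbert_fn gs m h /\ (h%:Z = (d * m)%:Z + c)%R.

(** Number of F-rational points in P^n(F) of the zero locus of [gs]:
    nonzero vectors of F^(n+1) on which all generators vanish, divided by
    |F^*| = |F| - 1 (the zero locus is a cone). *)
Definition rat_points (F : finFieldType) (n : nat) (gs : seq {mpoly F[n.+1]}) : nat :=
  (#|[set v : {ffun 'I_n.+1 -> F} |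
        (v != 0%R) && all (fun g => g.@[v] == 0%R) gs]| %/ (#|F| - 1))%N.

(* Main.v *)
Require Import Defs.
From HB Require Import structures.
From mathcomp Require Import all_boot all_order all_algebra all_field.
From mathcomp Require Import mpoly zify ring.
Set Implicit Arguments. Unset Strict Implicit. Unset Printing Implicit Defensive.
Import GRing.Theory.
Local Open Scope ring_scope.

(** With [m = q - 1 >= 2], consider in P^(n+1), with coordinates z, x_0, ..., x_n,
    the curve [x_(i+1) ^ m = x_i ^ m + x_i * z ^ (m - 1)] for [i < n]. Rewriting
    [x_i ^ m] for [i >= 1] reduces every form to standard monomials, those in which
    x_1, ..., x_n have exponents [< m]; counting them gives the degree [m ^ n]. On
    [z = 0] there are already [m ^ n] rational points. For primality, near
    [z = 1, x = 0] the coordinate x_n = t is a uniformizer and x_i is a power series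
    in t of order [m ^ (n - i)], so, reading exponents as base-m digits, standard
    monomials of a given degree have distinct orders in t. Hence the coordinate ring
    embeds into a power series ring. Here power series are truncated modulo [t ^ N],
    and the grading is recorded by an extra factor [t ^ L] on each coordinate, with L
    large. *)

(** * Closure properties of ideal membership *)

Lemma in_ideal0 (R : comNzRingType) (N : nat) (gs : seq {mpoly R[N]}) :
  in_ideal gs 0.
Proof.
by exists (fun=> 0); rewrite big1 // => i _; rewrite mul0r.
Qed.

Lemma in_idealD (R : comNzRingType) (N : nat) (gs : seq {mpoly R[N]}) p r :
  in_ideal gs p -> in_ideal gs r -> in_ideal gs (p + r).
Proof.
move=> [a ->] [b ->]; exists (fun i => a i + b i); rewrite -big_split /=.
by apply: eq_bigr => i _; rewrite mulrDl.
Qed.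

Lemma in_idealMl (R : comNzRingType) (N : nat) (gs : seq {mpoly R[N]}) p r :
  in_ideal gs p -> in_ideal gs (r * p).
Proof.
move=> [a ->]; exists (fun i => r * a i); rewrite mulr_sumr.
by apply: eq_bigr => i _; rewrite mulrA.
Qed.

Lemma in_idealN (R : comNzRingType) (N : nat) (gs : seq {mpoly R[N]}) p :
  in_ideal gs p -> in_ideal gs (- p).
Proof. by rewrite -mulN1r; apply: in_idealMl. Qed.

Lemma in_idealZ (R : comNzRingType) (N : nat) (gs : seq {mpoly R[N]}) c p :
  in_ideal gs p -> in_ideal gs (c *: p).
Proof. by rewrite -mul_mpolyC; apply: in_idealMl. Qed.

Lemma in_ideal_gen (R : comNzRingType) (N : nat) (gs : seq {mpoly R[N]}) g :
  g \in gs -> in_ideal gs g.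
Proof.
move=> gg; have ig : (index g gs < size gs)%N by rewrite index_mem.
exists (fun i => (i == Ordinal ig)%:R); rewrite (bigD1 (Ordinal ig)) //= eqxx.
rewrite mul1r nth_index // big1 ?addr0 // => i /negbTE ->.
by rewrite mul0r.
Qed.

(** * Order of vanishing at 0 in one variable *)

Definition has_order (K : fieldType) (e : nat) (p : {poly K}) : Prop :=
  exists2 u : {poly K}, u.[0] != 0 & p = 'X^e * u.

Lemma has_order1 (K : fieldType) : has_order 0 (1 : {poly K}).
Proof. by exists 1; rewrite ?hornerC ?oner_eq0 // expr0 mulr1. Qed.

Lemma has_orderXn (K : fieldType) e : has_order e ('X^e : {poly K}).
Proof. by exists 1; rewrite ?hornerC ?oner_eq0 // mulr1. Qed.

Lemma has_orderM (K : fieldType) d e (p r : {poly K}) :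
  has_order d p -> has_order e r -> has_order (d + e) (p * r).
Proof.
move=> [u u0 ->] [v v0 ->]; exists (u * v); first by rewrite hornerM mulf_neq0.
by rewrite exprD; ring.
Qed.

Lemma has_order_exp (K : fieldType) e (p : {poly K}) k :
  has_order e p -> has_order (e * k) (p ^+ k).
Proof.
move=> ep; elim: k => [|k IHk]; first by rewrite muln0; apply: has_order1.
by rewrite exprS mulnS; apply: has_orderM.
Qed.

Lemma has_order_prod (K : fieldType) (I : Type) (s : seq I) (e : I -> nat)
    (p : I -> {poly K}) :
  (forall i, has_order (e i) (p i)) ->
  has_order (\sum_(i <- s) e i)%N (\prod_(i <- s) p i).
Proof.
move=> ep; elim: s => [|i s IHs]; first by rewrite !big_nil; apply: has_order1.
by rewrite !big_cons; apply: has_orderM.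
Qed.

Lemma has_orderZ (K : fieldType) e (p : {poly K}) c :
  c != 0 -> has_order e p -> has_order e (c *: p).
Proof.
move=> c0 [u u0 ->]; exists (c *: u); last by rewrite scalerAr.
by rewrite hornerZ mulf_neq0.
Qed.

Lemma has_order_dvd (K : fieldType) d e (p : {poly K}) :
  has_order e p -> (d <= e)%N -> 'X^d %| p.
Proof.
by move=> [u _ ->] de; apply: dvdp_mulr; apply: dvdp_exp2l.
Qed.

Lemma has_order_ndvd (K : fieldType) N e (p : {poly K}) :
  has_order e p -> (e < N)%N -> ~~ ('X^N %| p).
Proof.
move=> [u u0 ->] eN; apply/negP => /(dvdp_trans (dvdp_exp2l 'X eN)).
rewrite exprSr dvdp_mul2l ?expf_neq0 ?polyX_eq0 // -['X]subr0 -polyC0 dvdp_XsubCl.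
by rewrite /root (negbTE u0).
Qed.

Lemma has_orderDl (K : fieldType) e (p r : {poly K}) :
  has_order e p -> 'X^(e.+1) %| r -> has_order e (p + r).
Proof.
move=> [u u0 ->] /dvdpP[v ->]; exists (u + v * 'X).
  by rewrite hornerD hornerMX mulr0 addr0.
by rewrite exprS; ring.
Qed.

(** The term of strictly least order cannot be cancelled by the others. *)
Lemma has_order_sum (K : fieldType) (I : eqType) (s : seq I) (i0 : I)
    (c : I -> K) (e : I -> nat) (p : I -> {poly K}) :
  uniq s -> i0 \in s -> c i0 != 0 -> (forall i, has_order (e i) (p i)) ->
  (forall i, i \in s -> i != i0 -> (e i0 < e i)%N) ->
  has_order (e i0) (\sum_(i <- s) c i *: p i).
Proof.
move=> us si0 c0 ep lt_e; rewrite (bigD1_seq i0) //=.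
apply: has_orderDl; first exact: has_orderZ.
rewrite big_seq_cond; apply: (big_ind (fun r => 'X^_ %| r)) => [||i /andP[si ii0]].
- exact: dvdp0.
- by move=> x y; apply: dvdp_add.
by rewrite -mul_polyC dvdp_mull //; apply: has_order_dvd (ep i) _; apply: lt_e.
Qed.

(** * Truncated power series parametrization *)

(* Fixed-point iteration for the solution [x] of [x + x ^+ m = y ^+ m] modulo
   ['X^N]. *)
Definition branch (K : fieldType) (m N : nat) (y : {poly K}) : {poly K} :=
  iter N (fun x => y ^+ m - x ^+ m) (y ^+ m).

(** As [m > 1], the correction [x ^+ m] has order [e * m * m], strictly above that of the leading
    term [y ^+ m]. *)
Lemma branch_order (K : fieldType) m N e (y : {poly K}) :
  (1 < m)%N -> (0 < e)%N -> has_order e y -> has_order (e * m) (branch m N y).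
Proof.
move=> m1 e0 ey; elim: N => [|N IHN]; first exact: has_order_exp.
rewrite /branch iterS -/(branch m N y); apply: has_orderDl.
  exact: has_order_exp.
by rewrite dvdpNr; apply: has_order_dvd (has_order_exp m IHN) _; nia.
Qed.

(** Each iteration gains a factor ['X]. The new error is [x ^+ m - x' ^+ m], where [x - x'] is the
    old error up to sign and the cofactor vanishes at 0 because [x] and [x'] do and [m > 1]. *)
Lemma branch_eq (K : fieldType) m N e (y : {poly K}) :
  (1 < m)%N -> (0 < e)%N -> has_order e y ->
  'X^N %| y ^+ m - branch m N y ^+ m - branch m N y.
Proof.
move=> m1 e0 ey; elim: N => [|N IHN]; first by rewrite expr0 dvd1p.
have xP := @branch_order K m N e y m1 e0 ey.
have := @branch_order K m N.+1 e y m1 e0 ey.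
rewrite /branch iterS -/(branch m N y) => x'P.
set x := branch m N y in IHN xP x'P *; set x' := y ^+ m - x ^+ m in x'P *.
have -> : y ^+ m - x' ^+ m - x' = x ^+ m - x' ^+ m by rewrite /x'; ring.
rewrite subrXX exprSr; apply: dvdp_mul.
  by rewrite -dvdpNr opprB.
have Xx : 'X %| x by rewrite -['X]expr1; apply: has_order_dvd xP _; nia.
have Xx' : 'X %| x' by rewrite -['X]expr1; apply: has_order_dvd x'P _; nia.
apply: (big_ind (fun r => 'X %| r)) => [||[[|i] /= im] _].
- exact: dvdp0.
- by move=> a b; apply: dvdp_add.
- by rewrite dvdp_mulr // -(subnKC m1) /= subn0 exprS dvdp_mulr.
- by rewrite dvdp_mull // exprS dvdp_mulr.
Qed.

(* Index 0 stands for [z = 1] and index [i.+1] for x_i as a series in [t = x_n]. *)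
Definition param (K : fieldType) (n m N i : nat) : {poly K} :=
  if i is 0 then 1 else iter (n.+1 - i) (branch m N) 'X.

(** The order in [t] of the matching [param]. From index [n.+1] down to 1 these are the base-[m]
    place values 1, [m], [m ^ 2], and so on. *)
Definition wt (n m i : nat) : nat := if i is 0 then 0 else m ^ (n.+1 - i).

Lemma param_order (K : fieldType) n m N i :
  (1 < m)%N -> has_order (wt n m i) (param K n m N i).
Proof.
move=> m1; case: i => [|i]; first exact: has_order1.
rewrite /wt /param; elim: (n.+1 - i.+1)%N => [|k IHk].
  by rewrite expn0 -['X]expr1; apply: has_orderXn.
rewrite iterS expnSr; apply: branch_order => //; by rewrite expn_gt0 ltnW.
Qed.

Lemma param_eq (K : fieldType) n m N k : (1 < m)%N -> (k < n)%N ->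
  'X^N %| param K n m N k.+2 ^+ m - param K n m N k.+1 ^+ m - param K n m N k.+1.
Proof.
move=> m1 kn; rewrite /param; have -> : (n.+1 - k.+1 = (n.+1 - k.+2).+1)%N by lia.
rewrite iterS; apply: branch_eq (@param_order K n m N k.+2 m1) => //.
by rewrite expn_gt0 ltnW.
Qed.

(** * Defining equations and evaluation along the parametrization *)

(* [tvar 0] is z and [tvar i.+1] is x_i. *)
Definition tvar (R : comNzRingType) (n k : nat) : {mpoly R[n.+2]} := 'X_(inord k).

Definition tower_gen (R : comNzRingType) (n m k : nat) : {mpoly R[n.+2]} :=
  tvar R n k.+2 ^+ m - tvar R n k.+1 ^+ m - tvar R n k.+1 * tvar R n 0 ^+ m.-1.

Definition tower_gens (R : comNzRingType) (n m : nat) : seq {mpoly R[n.+2]} :=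
  mkseq (tower_gen R n m) n.

Definition tower_eval (K : fieldType) (n m N L : nat) : {mpoly K[n.+2]} -> {poly K} :=
  mmap polyC (fun i : 'I_n.+2 => 'X^L * param K n m N i).

HB.instance Definition _ (K : fieldType) (n m N L : nat) :=
  GRing.RMorphism.copy (tower_eval m N L)
    (mmap polyC (fun i : 'I_n.+2 => 'X^L * param K n m N i)).

Lemma tower_eval_var (K : fieldType) n m N L k : (k < n.+2)%N ->
  tower_eval m N L (tvar K n k) = 'X^L * param K n m N k.
Proof. by move=> kn; rewrite /tower_eval /tvar mmapX mmap1U inordK. Qed.

Lemma tower_eval_ideal (K : fieldType) n m N L (p : {mpoly K[n.+2]}) : (1 < m)%N ->
  in_ideal (tower_gens K n m) p -> 'X^N %| tower_eval m N L p.
Proof.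
move=> m1 [c ->]; rewrite rmorph_sum.
apply: (big_ind (fun r => 'X^N %| r)) => [||[i /= im] _].
- exact: dvdp0.
- by move=> a b; apply: dvdp_add.
rewrite rmorphM /=; apply: dvdp_mull.
move: im; rewrite size_mkseq => im; rewrite nth_mkseq // /tower_gen.
rewrite !rmorphB !rmorphM !rmorphXn /= !tower_eval_var; try lia.
rewrite [param K n m N 0]/= mulr1.
set z := 'X^L; set y := param _ _ _ _ _; set x := param _ _ _ _ _.
(* Homogeneity lets the grading factor [z ^+ m] come out, leaving the affine relation satisfied by
   [param]. *)
have -> : (z * y) ^+ m - (z * x) ^+ m - z * x * z ^+ m.-1 =
  z ^+ m * (y ^+ m - x ^+ m - x).
  by rewrite -(ltn_predK m1) !exprMn !exprS /=; ring.
by apply: dvdp_mull; apply: param_eq.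
Qed.

(** * Orders of monomials *)

Definition mord (n m L : nat) (mu : 'X_{1..n.+2}) : nat :=
  \sum_(i < n.+2) (L + wt n m i) * mu i.

Lemma tower_eval_mon_order (K : fieldType) n m N L (mu : 'X_{1..n.+2}) : (1 < m)%N ->
  has_order (mord m L mu) (tower_eval m N L ('X_[mu] : {mpoly K[n.+2]})).
Proof.
move=> m1; rewrite /tower_eval mmapX /mmap1; apply: has_order_prod => i.
by apply: has_order_exp; apply: has_orderM; [apply: has_orderXn|apply: param_order].
Qed.

Lemma tower_evalE (K : fieldType) n m N L (p : {mpoly K[n.+2]}) :
  tower_eval m N L p = \sum_(mu <- msupp p) p@_mu *: tower_eval m N L 'X_[mu].
Proof.
rewrite {1}(mpolyE p) rmorph_sum /=; apply: eq_bigr => mu _.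
by rewrite -mul_mpolyC rmorphM /= {1}/tower_eval mmapC mul_polyC.
Qed.

(** Uniqueness of base-[m] expansions, reading off the last digit modulo [m]. Index 0 is the leading
    entry and is unbounded, like the exponent of x_0. *)
Lemma horner_digits_inj (m n : nat) (a b : nat -> nat) :
  (forall i, (0 < i <= n)%N -> (a i < m)%N /\ (b i < m)%N) ->
  (\sum_(i < n.+1) m ^ (n - i) * a i = \sum_(i < n.+1) m ^ (n - i) * b i)%N ->
  forall i, (i <= n)%N -> a i = b i.
Proof.
elim: n => [|n IHn] ab_lt.
  rewrite !big_ord1 !mul1n => ab i; rewrite leqn0 => /eqP ->; exact: ab.
have split_last (c : nat -> nat) : (\sum_(i < n.+2) m ^ (n.+1 - i) * c i =
    m * (\sum_(i < n.+1) m ^ (n - i) * c i) + c n.+1)%N.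
  rewrite big_ord_recr /= subnn mul1n big_distrr /=; congr (_ + _)%N.
  by apply: eq_bigr => i _; rewrite mulnA -expnS subSn // -ltnS.
rewrite !split_last => e.
have [an bn] : (a n.+1 < m)%N /\ (b n.+1 < m)%N by apply: ab_lt; rewrite ltnSn.
have last_eq : a n.+1 = b n.+1.
  have := congr1 (modn^~ m) e; rewrite !(mulnC m) !modnMDl !modn_small //.
have m0 : (0 < m)%N by apply: leq_ltn_trans an.
move=> i; rewrite leq_eqVlt => /orP[/eqP -> //|]; rewrite ltnS; apply: IHn.
  by move=> j /andP[j0 jn]; apply: ab_lt; rewrite j0 leqW.
by move/eqP: e; rewrite last_eq eqn_add2r eqn_pmul2l // => /eqP.
Qed.

(** Indices 0 and 1 are [z] and x_0, whose exponents stay free. *)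
Definition std_mon (n m : nat) (mu : 'X_{1..n.+2}) : bool :=
  [forall i : 'I_n.+2, (1 < i)%N ==> (mu i < m)%N].

Definition std_poly (R : nzRingType) (n m : nat) (p : {mpoly R[n.+2]}) : bool :=
  all (std_mon m) (msupp p).

Lemma mordE n m L (mu : 'X_{1..n.+2}) :
  mord m L mu = (L * mdeg mu + mord m 0 mu)%N.
Proof.
rewrite mdegE big_distrr -big_split /=; apply: eq_bigr => i _.
by rewrite add0n mulnDl.
Qed.

Lemma mord0_inj n m (mu nu : 'X_{1..n.+2}) :
  std_mon m mu -> std_mon m nu -> mdeg mu = mdeg nu ->
  mord m 0 mu = mord m 0 nu -> mu = nu.
Proof.
move=> /forallP mus /forallP nus deg_eq ord_eq.
pose f (mu : 'X_{1..n.+2}) (i : nat) := mu (inord i.+1).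
have fE (k : 'X_{1..n.+2}) :
    mord m 0 k = (\sum_(i < n.+1) m ^ (n - i) * f k i)%N.
  rewrite /mord big_ord_recl /= add0n mul0n add0n; apply: eq_bigr => i _.
  rewrite add0n /f /=; congr (_ * k _)%N.
  by apply/val_inj; rewrite /= inordK //= ltnS.
have tail_eq (i : 'I_n.+2) : (0 < i)%N -> mu i = nu i.
  move=> i0; have -> : i = inord i.-1.+1 by apply/val_inj; rewrite /= prednK // inordK.
  apply: (@horner_digits_inj m n (f mu) (f nu)); last by have := ltn_ord i; lia.
    move=> j /andP[j0 jn].
    by split; rewrite /f; [have := mus (inord j.+1)|have := nus (inord j.+1)];
      rewrite inordK ?ltnS // j0.
  by rewrite -!fE.
(* The weight of [z] is 0, so its exponent is invisible to the order and is recovered from the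
   degree. *)
apply/mnmP => i; case: (posnP i) => [i0|]; last exact: tail_eq.
have -> : i = ord0 by apply/val_inj.
move: deg_eq; rewrite !mdegE (bigD1 (@ord0 n.+1)) //= [RHS](bigD1 (@ord0 n.+1)) //=.
rewrite (eq_bigr (fun j => nu j)) => [/eqP|j j0]; last by apply: tail_eq; rewrite lt0n.
by rewrite eqn_add2r => /eqP.
Qed.

(* For [L] large, distinct standard monomials get distinct orders. *)
Lemma tower_eval_order (K : fieldType) n m (p : {mpoly K[n.+2]}) :
  (1 < m)%N -> std_poly m p -> p != 0 ->
  exists L0, forall L, (L0 <= L)%N -> exists e, forall N,
    has_order e (tower_eval m N L p).
Proof.
move=> m1 /allP ps p0; exists (\max_(mu <- msupp p) mord m 0 mu).+1 => L leL.
have ltL mu : mu \in msupp p -> (mord m 0 mu < L)%N.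
  by move=> pmu; apply: leq_ltn_trans leL; apply: leq_bigmax_seq.
have ord_inj : {in msupp p &, injective (mord m L)}.
  move=> mu nu pmu pnu; rewrite (mordE m L mu) (mordE m L nu) => e.
  have L0 : (0 < L)%N by apply: leq_ltn_trans (ltL mu pmu).
  (* Division by [L] separates the two data: the quotient is the degree, the remainder is the order
     without grading. *)
  have := congr1 (divn^~ L) e; have := congr1 (modn^~ L) e.
  rewrite !(mulnC L) !modnMDl !divnMDl // !modn_small ?divn_small ?ltL //.
  rewrite !addn0 => ord_eq deg_eq; apply: mord0_inj (ps _ pmu) (ps _ pnu) deg_eq ord_eq.
have exo : exists k, k \in map (mord m L) (msupp p).
  case E: (msupp p) => [|mu s]; last by exists (mord m L mu); rewrite mem_head.
  by move/eqP: E p0; rewrite msupp_eq0 => ->.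
(* The support monomial of least order is unique by [ord_inj]; its order [mord m L mu] does not
   involve the truncation level [N]. *)
case: (ex_minnP exo) => k /mapP[mu pmu ->] min_mu.
exists (mord m L mu) => N; rewrite tower_evalE.
apply: (@has_order_sum K _ (msupp p) mu (fun nu => p@_nu)) => //.
- by rewrite -mcoeff_msupp.
- by move=> i; apply: tower_eval_mon_order.
move=> nu pnu nu_mu; rewrite ltn_neqAle min_mu ?map_f // andbT.
by apply: contraNneq nu_mu => /ord_inj -> .
Qed.

(** The order [e] of the image is the same for all truncation levels, so truncating at [e.+1]
    already detects a nonzero [p]. *)
Lemma std_ideal0 (K : fieldType) n m (p : {mpoly K[n.+2]}) :
  (1 < m)%N -> std_poly m p -> in_ideal (tower_gens K n m) p -> p = 0.
Proof.
move=> m1 ps pI; apply/eqP; apply: contraT => p0.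
have [L /(_ L (leqnn L))[e ep]] := tower_eval_order m1 ps p0.
by have := has_order_ndvd (ep e.+1) (ltnSn e); rewrite tower_eval_ideal.
Qed.

(** * Reduction to standard monomials *)

(* Strictly decreases when [x_i ^+ m] is rewritten. *)
Definition mweight (n : nat) (mu : 'X_{1..n.+2}) : nat := (\sum_(i < n.+2) i * mu i)%N.

Lemma mweightD n (mu nu : 'X_{1..n.+2}) :
  mweight (mu + nu)%MM = (mweight mu + mweight nu)%N.
Proof.
by rewrite -big_split; apply: eq_bigr => i _; rewrite mnmDE mulnDr.
Qed.

Lemma mweightMn n (i : 'I_n.+2) k : mweight (U_(i) *+ k)%MM = (i * k)%N.
Proof.
rewrite /mweight (bigD1 i) //= big1 ?addn0 => [|j ji].
  by rewrite mulmnE mnm1E eqxx mul1n.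
by rewrite mulmnE mnm1E eq_sym (negbTE ji) muln0.
Qed.

(** The predicate [D] tracks degrees through the reduction: [predT] serves for primality, [pred1 M]
    for the Hilbert function. *)
Definition reducible (R : comNzRingType) (n m : nat) (D : pred nat)
    (p : {mpoly R[n.+2]}) : Prop :=
  exists2 r, in_ideal (tower_gens R n m) (p - r) &
    all (fun mu => std_mon m mu && D (mdeg mu)) (msupp r).

Lemma reducible0 (R : comNzRingType) n m D : @reducible R n m D 0.
Proof. by exists 0; rewrite ?subr0 ?msupp0 //; apply: in_ideal0. Qed.

Lemma reducibleD (R : comNzRingType) n m D (p r : {mpoly R[n.+2]}) :
  reducible m D p -> reducible m D r -> reducible m D (p + r).
Proof.
move=> [p' pI /allP p'P] [r' rI /allP r'P]; exists (p' + r').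
  by rewrite opprD addrACA; apply: in_idealD.
apply/allP => mu /msuppD_le; rewrite mem_cat => /orP[/p'P|/r'P] //.
Qed.

Lemma reducibleZ (R : comNzRingType) n m D c (p : {mpoly R[n.+2]}) :
  reducible m D p -> reducible m D (c *: p).
Proof.
move=> [p' pI /allP p'P]; exists (c *: p').
  by rewrite -scalerBr; apply: in_idealZ.
by apply/allP => mu /msuppZ_le/p'P.
Qed.

Lemma reducible_mon (R : comNzRingType) n m (D : pred nat) (mu : 'X_{1..n.+2}) :
  (1 < m)%N -> D (mdeg mu) -> @reducible R n m D 'X_[mu].
Proof.
move=> m1; have [k] := ubnP (mweight mu); elim: k mu => // k IHk mu ltk Dmu.
case: (boolP (std_mon m mu)) => [smu|].
  by exists 'X_[mu]; rewrite ?subrr ?msuppX /= ?smu ?Dmu //; apply: in_ideal0.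
rewrite negb_forall => /existsP[i]; rewrite negb_imply -leqNgt => /andP[i1 mui].
have [j [jn iE]] : exists j, (j < n)%N /\ i = j.+2 :> nat.
  by exists (i - 2)%N; have := ltn_ord i; lia.
pose nu := (mu - U_(i) *+ m)%MM.
have muE : mu = (nu + U_(i) *+ m)%MM.
  apply/mnmP => l; rewrite mnmDE mnmBE mulmnE mnm1E.
  by case: eqP => [<-|]; rewrite ?mul1n ?mul0n ?subnK // subn0 addn0.
pose a : 'I_n.+2 := inord j.+1; pose z : 'I_n.+2 := inord 0.
have aE : a = j.+1 :> nat by rewrite inordK //; lia.
have zE : z = 0 :> nat by rewrite inordK.
(* The two monomials replacing [mu] when the relation rewrites the factor of exponent [m]: same
   degree, smaller [mweight]. *)
pose mu1 := (nu + U_(a) *+ m)%MM; pose mu2 := (nu + (U_(a) + U_(z) *+ m.-1))%MM.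
have degE : (mdeg mu1 = mdeg mu) /\ (mdeg mu2 = mdeg mu).
  by rewrite muE /mu1 /mu2 !(mdegD, mdegMn, mdeg1); lia.
have red1 : @reducible R n m D 'X_[mu1].
  apply: IHk; last by rewrite degE.1.
  move: ltk; rewrite muE !mweightD !mweightMn iE aE; nia.
have red2 : @reducible R n m D 'X_[mu2].
  apply: IHk; last by rewrite degE.2.
  move: ltk; rewrite muE !mweightD !mweightMn -[U_(a)%MM]mulm1n mweightMn iE aE zE; nia.
have [r rI rP] := reducibleD red1 red2.
exists r => //.
have -> : 'X_[mu] - r =
    'X_[nu] * tower_gen R n m j + ('X_[mu1] + 'X_[mu2] - r) :> {mpoly R[n.+2]}.
  rewrite muE /mu1 /mu2 !mpolyXD -!mpolyXn /tower_gen /tvar -/a -/z.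
  have -> : inord j.+2 = i by apply/val_inj; rewrite /= inordK -?iE.
  by ring.
apply: in_idealD => //; apply: in_idealMl; apply: in_ideal_gen.
by apply/mapP; exists j; rewrite // mem_iota.
Qed.

Lemma reducible_poly (R : comNzRingType) n m (D : pred nat) (p : {mpoly R[n.+2]}) :
  (1 < m)%N -> all (fun mu : 'X_{1..n.+2} => D (mdeg mu)) (msupp p) ->
  reducible m D p.
Proof.
move=> m1 /allP pD; rewrite (mpolyE p) big_seq; apply: big_ind.
- exact: reducible0.
- exact: reducibleD.
by move=> mu pmu; apply: reducibleZ; apply: reducible_mon => //; apply: pD.
Qed.

(** * Primality *)

(** Nonzero standard representatives have images of finite orders [d] and [e], so their product has
    order [d + e] and cannot lie in the ideal. *)
Lemma tower_prime (K : fieldType) n m : (1 < m)%N -> prime_ideal (tower_gens K n m).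
Proof.
move=> m1; split.
  have std1 : std_poly m (1 : {mpoly K[n.+2]}).
    rewrite /std_poly msupp1 /= andbT; apply/forallP => i.
    by rewrite mnm0E (ltn_trans _ m1) // implybT.
  by move=> /(std_ideal0 m1 std1)/eqP; rewrite oner_eq0.
have std_dec (p : {mpoly K[n.+2]}) : exists p', [/\ std_poly m p',
    in_ideal (tower_gens K n m) (p - p') &
    p' = 0 -> in_ideal (tower_gens K n m) p].
  have [|p' pI p's] := @reducible_poly K n m predT p m1; first exact/allP.
  exists p'; split => //; first by apply: sub_all p's => mu /andP[].
  by move=> p'0; move: pI; rewrite p'0 subr0.
move=> a b abI; have [a' [a's aI a'0]] := std_dec a; have [b' [b's bI b'0]] := std_dec b.
have [/a'0|a'n0] := eqVneq a' 0; first by left.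
have [/b'0|b'n0] := eqVneq b' 0; first by right.
have a'b'I : in_ideal (tower_gens K n m) (a' * b').
  have -> : a' * b' = a * b + - (b * (a - a') + a' * (b - b')) by ring.
  by apply: in_idealD => //; apply/in_idealN/in_idealD; apply: in_idealMl.
have [L1 aL] := tower_eval_order m1 a's a'n0.
have [L2 bL] := tower_eval_order m1 b's b'n0.
(* Both orders must be taken for the same evaluation, hence the common grading [maxn L1 L2]. *)
have [d dP] := aL _ (leq_maxl L1 L2); have [e eP] := bL _ (leq_maxr L1 L2).
have := has_orderM (dP (d + e).+1) (eP (d + e).+1).
rewrite -rmorphM => /has_order_ndvd/(_ (ltnSn _)).
by rewrite tower_eval_ideal.
Qed.

(** * Hilbert function *)

(** Standard monomials of degree [M] form a basis: independence is [std_ideal0], spanning is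
    degree-preserving reduction. *)
Lemma hilbert_fn_std (K : fieldType) (n m M : nat) (s : seq 'X_{1..n.+2}) :
  (1 < m)%N -> uniq s ->
  (forall mu, (mu \in s) = std_mon m mu && (mdeg mu == M)) ->
  hilbert_fn (tower_gens K n m) M (size s).
Proof.
move=> m1 us sP; pose mon (i : 'I_(size s)) := nth 0%MM s i.
have monP i : std_mon m (mon i) && (mdeg (mon i) == M) by rewrite -sP mem_nth.
have mon_inj : injective mon.
  by move=> i j /eqP; rewrite nth_uniq // => /eqP /val_inj.
have coefE (c : 'I_(size s) -> K) i :
    (\sum_(j < size s) c j *: 'X_[mon j])@_(mon i) = c i.
  rewrite raddf_sum (bigD1 i) //= mcoeffZ mcoeffX eqxx mulr1 big1 ?addr0 // => j ji.
  by rewrite mcoeffZ mcoeffX (inj_eq mon_inj) (negbTE ji) mulr0.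
exists (fun i => 'X_[mon i]); split; [|split].
- by move=> i; rewrite dhomogX; case/andP: (monP i).
- move=> c cI i; rewrite -(coefE c i) (@std_ideal0 K n m _ m1 _ cI) ?mcoeff0 //.
  rewrite /std_poly; apply: (big_ind (fun p : {mpoly K[n.+2]} => all (std_mon m) (msupp p))).
  + by rewrite msupp0.
  + move=> p r /allP pS /allP rS; apply/allP => mu /msuppD_le.
    by rewrite mem_cat => /orP[/pS|/rS].
  + move=> j _; apply/allP => mu /msuppZ_le; rewrite msuppX inE => /eqP ->.
    by case/andP: (monP j).
move=> p /dhomogP pM.
have [|r pI /allP rS] := @reducible_poly K n m (pred1 M) p m1.
  by apply/allP => mu /pM /= ->.
exists (fun i => r@_(mon i)).
have -> // : \sum_(i < size s) r@_(mon i) *: 'X_[mon i] = r.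
apply/mpolyP => mu; case: (boolP (mu \in s)) => smu.
  have i_lt : (index mu s < size s)%N by rewrite index_mem.
  have -> : mu = mon (Ordinal i_lt) by rewrite /mon nth_index.
  exact: coefE.
rewrite (@memN_msupp_eq0 _ _ r); last by apply: contra smu => /rS; rewrite sP.
rewrite raddf_sum big1 // => i _ /=; rewrite mcoeffZ mcoeffX.
case: eqP => [e|]; last by rewrite mulr0.
by rewrite -e sP monP in smu.
Qed.

(** Here [e] gives the exponents of x_1, ..., x_n, [j] that of [z], and x_0 takes up the rest of the
    degree [M]. *)
Definition std_mon_of (n m M : nat) (e : {ffun 'I_n -> 'I_m}) (j : nat) : 'X_{1..n.+2} :=
  [multinom (match split (i : 'I_(2 + n)) with
             | inl k => if k == ord0 then j else (M - \sum_l e l - j)%N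
             | inr l => e l end) | i < n.+2].

Definition std_mons (n m M : nat) : seq 'X_{1..n.+2} :=
  [seq std_mon_of M e j | e : {ffun 'I_n -> 'I_m} <- enum {: {ffun 'I_n -> 'I_m}},
                          j <- iota 0 (M - \sum_l e l).+1].

Lemma std_mon_ofr n m M (e : {ffun 'I_n -> 'I_m}) j (l : 'I_n) :
  std_mon_of M e j (rshift 2 l) = e l.
Proof. by rewrite mnmE -/(unsplit (inr l)) unsplitK. Qed.

Lemma std_mon_ofl n m M (e : {ffun 'I_n -> 'I_m}) j (k : 'I_2) :
  std_mon_of M e j (@lshift 2 n k) = if k == ord0 then j else (M - \sum_l e l - j)%N.
Proof. by rewrite mnmE -/(unsplit (inl k)) unsplitK. Qed.

Lemma mdeg_split n (mu : 'X_{1..n.+2}) :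
  mdeg mu = (mu (@lshift 2 n ord0) + mu (@lshift 2 n ord_max)
             + \sum_(l < n) mu (rshift 2 l))%N.
Proof.
rewrite mdegE (@big_split_ord _ _ _ 2 n) /= big_ord_recl big_ord1.
by congr (_ + mu (@lshift 2 n _) + _)%N; apply/val_inj.
Qed.

Lemma std_mons_uniq (n m M : nat) : uniq (std_mons n m M).
Proof.
apply: allpairs_uniq_dep; [exact: enum_uniq|by move=> *; apply: iota_uniq|].
move=> [e j] [f k] _ _ /= ejk.
have ef : e = f.
  by apply/ffunP => l; apply/val_inj; rewrite /= -!(std_mon_ofr M _ j) ejk !std_mon_ofr.
move: ejk; rewrite ef => /(congr1 (fun mu : 'X_{1..n.+2} => mu (@lshift 2 n ord0))).
by rewrite !std_mon_ofl /= => ->.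
Qed.

(** The bound on [M] keeps the subtraction [M - \sum_l e l] from being cut off at 0. *)
Lemma mem_std_mons (n m M : nat) (mu : 'X_{1..n.+2}) : (n * m <= M)%N ->
  (mu \in std_mons n m M) = std_mon m mu && (mdeg mu == M).
Proof.
move=> nmM; apply/allpairsPdep/andP.
  move=> [e [j [_]]]; rewrite mem_iota add0n /= ltnS => jM ->; split.
    apply/forallP => i; apply/implyP; rewrite -(splitK (i : 'I_(2 + n))).
    by case: split => [k|l] /=; [rewrite leqNgt ltn_ord|rewrite std_mon_ofr].
  rewrite mdeg_split !std_mon_ofl /=.
  rewrite [X in (_ + X)%N](eq_bigr (fun l => e l : nat)) => [|l _]; last exact: std_mon_ofr.
  have leM : (\sum_l e l <= M)%N.
    apply: leq_trans nmM; rewrite -[X in (X * _)%N]card_ord -sum_nat_const.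
    by apply: leq_sum => l _; apply: ltnW.
  by apply/eqP; rewrite subnKC // subnK.
move=> [/forallP mus /eqP muM].
have mu_lt (l : 'I_n) : (mu (rshift 2 l) < m)%N by apply: (implyP (mus _)).
pose e := [ffun l => Ordinal (mu_lt l)].
have eE : (\sum_l e l = \sum_(l < n) mu (rshift 2 l))%N.
  by apply: eq_bigr => l _; rewrite ffunE.
rewrite mdeg_split in muM.
exists e, (mu (@lshift 2 n ord0)); split; first by rewrite mem_enum.
  by rewrite mem_iota add0n eE /= ltnS -muM addnK leq_addr.
apply/mnmP => i; rewrite -(splitK (i : 'I_(2 + n))); case: split => [k|l] /=.
  rewrite std_mon_ofl; case: eqP => [-> //|k0].
  have -> : k = ord_max by apply/val_inj; case: k k0 => [[|[|]]] // ? [] ; apply/val_inj.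
  by rewrite eE -muM addnK addKn.
by rewrite std_mon_ofr ffunE.
Qed.

(** Each of the [m ^ n] vectors [e] leaves [M - \sum_l e l + 1] exponents for [z], so the count is
    linear in [M] with slope [m ^ n]. *)
Lemma size_std_mons (n m M : nat) : (n * m <= M)%N ->
  (size (std_mons n m M))%:Z =
  (m ^ n * M)%:Z + \sum_(e : {ffun 'I_n -> 'I_m}) (1 - (\sum_l e l)%N%:Z).
Proof.
move=> nmM; rewrite /std_mons size_allpairs_dep sumnE big_map big_enum /=.
under eq_bigr do rewrite size_iota.
have -> : (m ^ n * M)%:Z = \sum_(e : {ffun 'I_n -> 'I_m}) M%:Z.
  by rewrite sumr_const card_ffun !card_ord -mulr_natl natz -PoszM.
rewrite -big_split /= -[LHS]natz natr_sum.
apply: eq_bigr => e _; rewrite natz.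
have leM : (\sum_l e l <= M)%N.
  apply: leq_trans nmM; rewrite -[X in (X * _)%N]card_ord -sum_nat_const.
  by apply: leq_sum => l _; apply: ltnW.
by rewrite -addn1 PoszD -subzn // addrA addrAC.
Qed.

(** * Base change, degree and rational points *)

(** The equations have integer coefficients, so primality over every field gives geometric
    primality. *)
Lemma map_tower_gens (F K : fieldType) (f : {rmorphism F -> K}) n m :
  [seq map_mpoly f g | g <- tower_gens F n m] = tower_gens K n m.
Proof.
rewrite -map_comp; apply: eq_map => k.
by rewrite /= /tower_gen !rmorphB !rmorphM !rmorphXn /= /tvar !map_mpolyX.
Qed.

Lemma tower_gen_homog (R : comNzRingType) n m k : (0 < m)%N ->
  tower_gen R n m k \is m.-homog.
Proof.
move=> m0.
have varX i d : tvar R n i ^+ d \is d.-homog.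
  by rewrite /tvar mpolyXn dhomogX /= mdegMn mdeg1 mul1n.
rewrite /tower_gen !rpredB //.
by have := dhomogM (varX k.+1 1%N) (varX 0%N m.-1); rewrite expr1 add1n prednK.
Qed.

Lemma tower_curve (F : fieldType) n m : (1 < m)%N ->
  @proj_curve F n.+1 (m ^ n) (tower_gens F n m).
Proof.
move=> m1; have m0 := ltnW m1; split; [|split; [|split]].
- by move=> g /mapP[k _ ->]; exists m; apply: tower_gen_homog.
- by move=> K f; rewrite map_tower_gens; apply: tower_prime.
- by rewrite expn_gt0 m0.
exists (\sum_(e : {ffun 'I_n -> 'I_m}) (1 - (\sum_l e l)%N%:Z)), (n * m)%N => M leM.
exists (size (std_mons n m M)); split; last exact: size_std_mons.
apply: hilbert_fn_std => //; first exact: std_mons_uniq.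
by move=> mu; apply: mem_std_mons.
Qed.

(* On the hyperplane [z = 0] the equations read [x_(i+1) ^+ m = x_i ^+ m], which
   hold for all nonzero [x_i] since [m = q - 1]. *)
Lemma tower_rat_points (F : finFieldType) n : (2 < #|F|)%N ->
  (#|F|.-1 ^ n <= @rat_points F n.+1 (tower_gens F n #|F|.-1))%N.
Proof.
move=> q2; rewrite /rat_points subn1; have m0 : (0 < #|F|.-1)%N by lia.
(* After clearing the denominator, [#|F|.-1 ^ n.+1] vectors are required: those with [z = 0] and the
   other [n.+1] coordinates nonzero. *)
rewrite leq_divRL // -expnSr.
have cardD : #|predC1 (ord0 : 'I_n.+2)| = n.+1 by rewrite cardC1 card_ord.
have cardR : #|predC1 (0 : F)| = #|F|.-1 by rewrite cardC1.
rewrite -[X in (_ ^ X)%N]cardD -[X in (X ^ _)%N]cardR -(card_pffun_on 0).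
apply/subset_leq_card/subsetP => v /pffun_onP[/subsetP v0 vn0].
have vz : v ord0 = 0.
  by apply/eqP; apply: contraT => /v0; rewrite inE eqxx.
have vx i : i != ord0 -> v i != 0 by move=> i0; apply: vn0; apply: image_f.
rewrite inE; apply/andP; split.
  by apply: contraNneq (vx (lift ord0 ord0) isT) => ->; rewrite ffunE.
apply/allP => g /mapP[k]; rewrite mem_iota add0n /= => kn ->.
have xE i : (0 < i < n.+2)%N -> (tvar F n i).@[v] ^+ #|F|.-1 = 1.
  move=> /andP[i0 iN]; rewrite /tvar mevalXU; set x := v _.
  have x0 : x != 0 by apply: vx; rewrite -val_eqE /= inordK // -lt0n.
  by apply: (mulfI x0); rewrite -exprS prednK ?mulr1 ?expf_card //; lia.
rewrite /tower_gen !mevalB mevalM !rmorphXn /= !xE; try lia.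
have -> : (tvar F n 0).@[v] = 0.
  by rewrite /tvar mevalXU -vz; congr (v _); apply/val_inj; rewrite /= inordK.
(* Since [q > 2], the exponent [m - 1] of [z] is positive and the mixed term vanishes at [z = 0]. *)
by case E: #|F|.-2 => [|l]; [lia|rewrite exprS mul0r mulr0 subr0 subrr].
Qed.

Unset Implicit Arguments.

(** D(q) = limsup_d M_q(d)/d >= 1, unfolded: for every k >= 1 there are
    arbitrarily large d admitting an irreducible curve of degree d in some P^n
    over F_q with at least (1 - 1/k) d rational points. *)
Theorem theorem1p1 (F : finFieldType) (hq : (2 < #|F|)%N) :
  forall k : nat, (0 < k)%N -> forall d0 : nat,
    exists d : nat, (d0 <= d)%N /\
      exists (n : nat) (gs : seq {mpoly F[n.+1]}),
        @proj_curve F n d gs /\ ((k - 1) * d <= k * rat_points gs)%N.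
Proof.
move=> k k0 d0; have m1 : (1 < #|F|.-1)%N by lia.
(* Taking [d0] itself as the number of equations suffices, because [d0 < m ^ d0] for [m >= 2]. *)
exists (#|F|.-1 ^ d0)%N; split; first exact/ltnW/ltn_expl.
exists d0.+1, (tower_gens F d0 #|F|.-1); split; first exact: tower_curve.
by apply: leq_mul; [rewrite leq_subr|apply: tower_rat_points].
Qed.
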